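(* For every integer $d\ge1$, $$c(d,d+1,2)=\sqrt{2+\frac2d}.$$ Moreover, a system of unit vectors $u_1,\dots,u_{d+1}\in S^{d-1}$ attains the sharp bound, that is, satisfies $$\max_{1\le i<j\le d+1,\ \varepsilon,\varepsilon'\in\{\pm1\}}|\varepsilon u_i+\varepsilon' u_j|=\sqrt{2+\frac2d},$$ if and only if, up to sign changes (i.e. after replacing some of the vectors $u_i$ by $-u_i$), it forms the vertex set of a regular $d$-dimensional simplex inscribed in $S^{d-1}$.
   Context: $S^{d-1}$ denotes the unit sphere of $\mathbb{R}^d$ and $|\cdot|$ the Euclidean norm. For integers $d\ge1$, $n\ge 1$ and $1\le k\le n$, $c(d,n,k)$ is the largest value such that for every set of unit vectors $u_1,\dots,u_n\in S^{d-1}$ (repetitions allowed) there exist indices $1\le i_1<\dots<i_k\le n$ and signs $\varepsilon_1,\dots,\varepsilon_k\in\{\pm1\}$ with $|\varepsilon_1u_{i_1}+\dots+\varepsilon_ku_{i_k}|\ge c(d,n,k)$. Equivalently, $$c(d,n,k)=\min_{u_1,\dots,u_n\in S^{d-1}}\ \max_{1\le i_1<\dots<i_k\le n,\ \varepsilon\in\{\pm1\}^k}\Big|\sum_{j=1}^k\varepsilon_ju_{i_j}\Big|.$$ *)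

(* Defs.v *)
From mathcomp Require Import all_boot all_order all_algebra.
From mathcomp Require Import all_classical all_reals.

Set Implicit Arguments.
Unset Strict Implicit.
Unset Printing Implicit Defensive.

Import Order.TTheory GRing.Theory Num.Theory.

Local Open Scope classical_set_scope.
Local Open Scope ring_scope.

(* The norm `|_| that MathComp-Analysis puts on matrices is the sup norm,
   hence an explicit Euclidean norm. *)
Definition enorm (R : realType) (d : nat) (x : 'rV[R]_d) : R :=
  Num.sqrt (\sum_(i < d) x 0 i ^+ 2).

Definition unit_system (R : realType) (d n : nat) (u : 'I_n -> 'rV[R]_d) : Prop :=
  forall i, enorm (u i) = 1.

(* Signs are encoded by booleans: (-1) ^+ true = -1 and (-1) ^+ false = 1. *)
Definition signed_sum (R : realType) (d n k : nat) (u : 'I_n -> 'rV[R]_d)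
    (i : {ffun 'I_k -> 'I_n}) (e : {ffun 'I_k -> bool}) : 'rV[R]_d :=
  \sum_(j < k) (-1) ^+ e j *: u (i j).

Definition guaranteed (R : realType) (d n k : nat) : set R :=
  [set t : R | forall u : 'I_n -> 'rV[R]_d, unit_system u ->
     exists (i : {ffun 'I_k -> 'I_n}) (e : {ffun 'I_k -> bool}),
       {homo i : a b / (a < b)%N} /\ t <= enorm (signed_sum u i e)].
Arguments guaranteed R d n k : clear implicits.

(* The supremum is a genuine maximum when 0 < d and k <= n:
   see [c_guaranteed] and [c_largest]. *)
Definition c (R : realType) (d n k : nat) : R := sup (guaranteed R d n k).

(* Norms are nonnegative, so the default value 0 of the iterated maximum does
   not affect the result when 2 <= n. *)
Definition max_pair_norm (R : realType) (d n : nat) (u : 'I_n -> 'rV[R]_d) : R :=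
  \big[Num.max/0]_(i < n) \big[Num.max/0]_(j < n | (i < j)%N)
    \big[Num.max/0]_(e : bool) \big[Num.max/0]_(e' : bool)
      enorm ((-1) ^+ e *: u i + (-1) ^+ e' *: u j).

Definition affinely_independent (R : realType) (d m : nat)
    (v : 'I_m.+1 -> 'rV[R]_d) : Prop :=
  free [tuple v (lift ord0 i) - v ord0 | i < m].

(* v enumerates the vertices of a regular m-dimensional simplex: a
   nondegenerate simplex all of whose edges have the same length. *)
Definition regular_simplex (R : realType) (d m : nat)
    (v : 'I_m.+1 -> 'rV[R]_d) : Prop :=
  affinely_independent v /\
  exists l : R, forall i j, i != j -> enorm (v i - v j) = l.

Definition inscribed_in_sphere (R : realType) (d m : nat)
    (v : 'I_m.+1 -> 'rV[R]_d) : Prop := forall i, enorm (v i) = 1.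

Definition regular_simplex_up_to_signs (R : realType) (d m : nat)
    (u : 'I_m.+1 -> 'rV[R]_d) : Prop :=
  exists s : 'I_m.+1 -> bool,
    let w := fun i => (-1) ^+ s i *: u i in
    regular_simplex w /\ inscribed_in_sphere w.

Section CIsMaximum.
Variables (R : realType) (d n k : nat).
Hypotheses (d_gt0 : (0 < d)%N) (kn : (k <= n)%N).

Let M (u : 'I_n -> 'rV[R]_d) : R :=
  \big[Num.max/0]_(p : {ffun 'I_k -> 'I_n} * {ffun 'I_k -> bool}
                     | `[< {homo p.1 : a b / (a < b)%N} >])
    enorm (signed_sum u p.1 p.2).

Let le_M u (i : {ffun 'I_k -> 'I_n}) (e : {ffun 'I_k -> bool}) :
  {homo i : a b / (a < b)%N} -> enorm (signed_sum u i e) <= M u.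
Proof.
move=> hi; rewrite /M (bigmaxD1 (i, e)) /=; last exact/asboolP.
by rewrite le_max lexx.
Qed.

Let M_reached u : exists (i : {ffun 'I_k -> 'I_n}) (e : {ffun 'I_k -> bool}),
  {homo i : a b / (a < b)%N} /\ M u <= enorm (signed_sum u i e).
Proof.
pose i0 : {ffun 'I_k -> 'I_n} := [ffun j => widen_ord kn j].
pose e0 : {ffun 'I_k -> bool} := [ffun=> false].
rewrite /M; apply: (big_ind (fun x =>
  exists (i : {ffun 'I_k -> 'I_n}) (e : {ffun 'I_k -> bool}),
  {homo i : a b / (a < b)%N} /\ x <= enorm (signed_sum u i e))).
- exists i0, e0; split=> [a b ab|]; first by rewrite !ffunE.
  exact: sqrtr_ge0.
- move=> x y hx hy; rewrite /Num.max; case: ifP => _; [exact: hy|exact: hx].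
- by move=> [i e] /asboolP hi; exists i, e.
Qed.

Let has_sup_guaranteed : has_sup (guaranteed R d n k).
Proof.
split.
  exists 0 => u _; have [i [e [hi _]]] := M_reached u.
  by exists i, e; split=> //; exact: sqrtr_ge0.
pose u (i : 'I_n) : 'rV[R]_d := delta_mx 0 (Ordinal d_gt0).
exists (M u) => t /(_ u) []; last by move=> i [e [hi le]]; exact/(le_trans le)/le_M.
move=> i; rewrite /enorm (bigD1 (Ordinal d_gt0)) //= mxE !eqxx expr1n.
rewrite big1 ?addr0 ?sqrtr1 // => j /negbTE jN.
by rewrite mxE eqxx jN expr0n.
Qed.

Lemma c_guaranteed : guaranteed R d n k (c R d n k).
Proof.
move=> u hu; have [i [e [hi Mle]]] := M_reached u.
exists i, e; split=> //; apply: le_trans Mle.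
apply: ge_sup; first by case: has_sup_guaranteed.
by move=> t /(_ u hu) [i' [e' [hi' le']]]; exact/(le_trans le')/le_M.
Qed.

Lemma c_largest t : guaranteed R d n k t -> t <= c R d n k.
Proof. by apply: ub_le_sup; case: has_sup_guaranteed. Qed.

End CIsMaximum.

(* Main.v *)
Require Import Defs.
From mathcomp Require Import all_boot all_order all_algebra.
From mathcomp Require Import all_classical all_reals.
From mathcomp Require Import ring lra.
Import Order.TTheory GRing.Theory Num.Theory.
Local Open Scope ring_scope.

(** For unit vectors, |e u_i + e' u_j|^2 = 2 + 2 e e' <u_i, u_j>, so that the
    largest norm of a signed sum of two of them is sqrt (2 + 2 m), where m is
    the coherence of the system, that is, the largest |<u_i, u_j>|, i <> j.
    Everything thus reduces to the claim that d+1 unit vectors of R^d have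
    coherence at least 1/d, with equality exactly for simplices up to signs.

    Being d+1 vectors in dimension d, the u_j satisfy a nontrivial relation
    \sum_j x_j u_j = 0. Pairing it with x_i u_i, where |x_i| is maximal, gives
    x_i^2 = - \sum_(j <> i) x_i x_j <u_j, u_i>, a sum of d terms of size at most
    m x_i^2. So if m <= 1/d, then every term reaches its bound; this forces
    |x_j| = |x_i| for all j, so that every index is maximal, and flipping each
    u_j by the sign of x_j makes all the inner products equal to -1/d
    ([coherence_sharp_signs]). In particular m < 1/d is impossible, and m = 1/d
    leaves only one Gram matrix up to signs. Vectors with these inner products
    are affinely independent and equidistant ([equiangular_regular_simplex]).

    Conversely, the vertices of an inscribed regular simplex have one common
    inner product t <> 1. Against such a Gram matrix the relation above must
    have constant coefficients, which gives 1 + d t = 0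
    ([regular_simplex_dot]). Finally [simplex_vertex] shows in coordinates that
    such systems exist, so that the bound is the exact value of c. *)

(** * Inner products and pair norms *)

Definition dot (R : realType) (d : nat) (x y : 'rV[R]_d) : R :=
  \sum_(i < d) x 0 i * y 0 i.
Arguments dot {R d} x y.

Section Dot.
Variables (R : realType) (d : nat).
Implicit Types x y z : 'rV[R]_d.

Lemma dotC x y : dot x y = dot y x.
Proof. by apply: eq_bigr => i _; rewrite mulrC. Qed.

Lemma dotDl x y z : dot (x + y) z = dot x z + dot y z.
Proof. by rewrite -big_split; apply: eq_bigr => i _; rewrite mxE mulrDl. Qed.

Lemma dotZl a x y : dot (a *: x) y = a * dot x y.
Proof. by rewrite mulr_sumr; apply: eq_bigr => i _; rewrite mxE mulrA. Qed.

Lemma dot0l y : dot 0 y = 0.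
Proof. by rewrite /dot big1 // => i _; rewrite mxE mul0r. Qed.

Lemma dot_suml (I : finType) (F : I -> 'rV[R]_d) y :
  dot (\sum_i F i) y = \sum_i dot (F i) y.
Proof.
apply: (big_morph (fun x => dot x y)); last exact: dot0l.
by move=> a b; rewrite dotDl.
Qed.

Lemma dotDr x y z : dot x (y + z) = dot x y + dot x z.
Proof. by rewrite !(dotC x) dotDl. Qed.

Lemma dotZr a x y : dot x (a *: y) = a * dot x y.
Proof. by rewrite !(dotC x) dotZl. Qed.

Lemma enormE x : enorm x = Num.sqrt (dot x x).
Proof. by rewrite /enorm; congr Num.sqrt; apply: eq_bigr => i _; rewrite expr2. Qed.

Lemma dot_ge0 x : 0 <= dot x x.
Proof. by apply: sumr_ge0 => i _; rewrite -expr2 sqr_ge0. Qed.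

Lemma enorm_eq1 x : enorm x = 1 <-> dot x x = 1.
Proof.
rewrite enormE; split=> [h|->]; last exact: sqrtr1.
by rewrite -(sqr_sqrtr (dot_ge0 x)) h expr1n.
Qed.

Lemma enorm_pair (e e' : bool) x y : enorm x = 1 -> enorm y = 1 ->
  enorm ((-1) ^+ e *: x + (-1) ^+ e' *: y)
  = Num.sqrt (2 + 2 * ((-1) ^+ (e (+) e') * dot x y)).
Proof.
move=> /enorm_eq1 hx /enorm_eq1 hy; rewrite enormE; congr Num.sqrt.
rewrite dotDl !dotDr !dotZl !dotZr hx hy (dotC y x).
by case: e; case: e' => /=; ring.
Qed.

Lemma sqr_enorm_sub x y : enorm x = 1 -> enorm y = 1 ->
  enorm (x - y) ^+ 2 = 2 - 2 * dot x y.
Proof.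
move=> /enorm_eq1 hx /enorm_eq1 hy; rewrite enormE sqr_sqrtr ?dot_ge0 //.
by rewrite -scaleN1r dotDl !dotDr !dotZl !dotZr hx hy (dotC y x); ring.
Qed.

Lemma enorm_eq0 x : enorm x = 0 -> x = 0.
Proof.
rewrite enormE => /eqP; rewrite sqrtr_eq0 => le0.
have s0 : dot x x = 0 by apply/le_anti; rewrite le0 dot_ge0.
apply/rowP => k; rewrite mxE; apply/eqP; rewrite -sqrf_eq0 expr2.
by apply/eqP; apply: (psumr_eq0P _ s0) => // m _; rewrite -expr2 sqr_ge0.
Qed.

Lemma enorm_pair_le (e e' : bool) x y m : enorm x = 1 -> enorm y = 1 ->
  `|dot x y| <= m ->
  enorm ((-1) ^+ e *: x + (-1) ^+ e' *: y) <= Num.sqrt (2 + 2 * m).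
Proof.
move=> hx hy hm; rewrite enorm_pair //; apply: ler_wsqrtr.
rewrite lerD2l ler_pM2l //; apply: le_trans hm.
by apply: le_trans (ler_norm _) _; rewrite normrM normr_sign mul1r.
Qed.

(** Flipping y when <x, y> < 0 makes the inner product nonnegative, so that the
    bound of [enorm_pair_le] with m = |<x, y>| is reached. *)
Lemma enorm_pair_max x y : enorm x = 1 -> enorm y = 1 ->
  enorm ((-1) ^+ false *: x + (-1) ^+ (dot x y < 0)%R *: y)
  = Num.sqrt (2 + 2 * `|dot x y|).
Proof. by move=> hx hy; rewrite enorm_pair // addFb [in RHS]normrEsign. Qed.

End Dot.

(** * The coherence bound for d+1 unit vectors *)

Section Coherence.
Variables (R : realType) (d : nat).
Implicit Types u w : 'I_d.+1 -> 'rV[R]_d.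

(** The d+1 rows u_j of a matrix with d columns are dependent. *)
Lemma linear_relation u :
  exists x : 'I_d.+1 -> R, (exists i, x i != 0) /\
    forall y, \sum_j x j * dot (u j) y = 0.
Proof.
pose U : 'M[R]_(d.+1, d) := \matrix_(i < d.+1) u i.
have : kermx U != 0.
  by rewrite kermx_eq0 /row_free neq_ltn ltnS rank_leq_col.
move=> /rowV0Pn[v /sub_kermxP vU v0]; exists (v 0); split.
  by move/rV0Pn: v0.
move=> y; have := dot0l R d y.
rewrite -[X in dot X y]vU mulmx_sum_row dot_suml => S; rewrite -[RHS]S.
by apply: eq_bigr => j _; rewrite dotZl rowK.
Qed.

Lemma relation_off_diagonal u (x : 'I_d.+1 -> R) i :
  enorm (u i) = 1 -> \sum_j x j * dot (u j) (u i) = 0 ->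
  \sum_(j | j != i) x j * dot (u j) (u i) = - x i.
Proof.
move=> /enorm_eq1 hu; rewrite (bigD1 i) //= hu mulr1 => /eqP.
by rewrite addrC addr_eq0 => /eqP.
Qed.

Lemma card_neq_ord (i : 'I_d.+1) : #|[pred j | j != i]| = d.
Proof. by rewrite cardC1 card_ord. Qed.

(** Pairing the relation with x_i u_i gives
    x_i^2 = \sum_(j <> i) (- x_i x_j <u_j, u_i>). There are d summands, each at
    most x_i^2 / d because |x_i| is maximal, so all of them reach this bound. *)
Lemma relation_summands_tight u (x : 'I_d.+1 -> R) i : (0 < d)%N ->
  unit_system u ->
  (forall y, \sum_j x j * dot (u j) y = 0) ->
  (forall j, j != i -> `|dot (u j) (u i)| <= d%:R^-1) ->
  (forall j, `|x j| <= `|x i|) ->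
  forall j, j != i -> x i * (x j * dot (u j) (u i)) = - (d%:R^-1 * x i ^+ 2).
Proof.
move=> d0 hu hx hm hi.
have dn0 : d%:R != 0 :> R by rewrite pnatr_eq0 -lt0n.
(* The slack of the j-th summand in its bound. *)
pose gap j := d%:R^-1 * x i ^+ 2 + x i * (x j * dot (u j) (u i)).
have gap_ge0 j : j != i -> 0 <= gap j.
  move=> ji; rewrite /gap -[X in _ + X]opprK subr_ge0.
  apply: le_trans (ler_norm _) _.
  rewrite normrN mulrA mulrC !normrM -[x i ^+ 2]ger0_norm ?sqr_ge0 //.
  rewrite normrX expr2; apply: ler_pM => //; first exact: mulr_ge0.
    exact: hm.
  exact: ler_wpM2l.
have gap_sum : \sum_(j | j != i) gap j = 0.
  rewrite big_split /= -[X in _ + X]mulr_sumr.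
  rewrite (relation_off_diagonal _ _ _ (hu i) (hx _)).
  rewrite (sumr_const [pred j | j != i]) card_neq_ord.
  by field.
move=> j ji; have := psumr_eq0P gap_ge0 gap_sum ji.
by rewrite /gap addrC => /eqP; rewrite addr_eq0 => /eqP.
Qed.

Lemma exists_argmax (x : 'I_d.+1 -> R) : exists i, forall j, `|x j| <= `|x i|.
Proof.
case: (@arg_maxP _ _ _ (ord0 : 'I_d.+1) xpredT (fun i => `|x i|) isT) => i _ hi.
by exists i => j; exact: hi.
Qed.

Lemma argmax_neq0 (x : 'I_d.+1 -> R) i :
  (exists k, x k != 0) -> (forall j, `|x j| <= `|x i|) -> x i != 0.
Proof.
move=> [k hk] hi; apply: contraNneq hk => xi0.
by have := hi k; rewrite xi0 normr0 normr_le0.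
Qed.

(** Tightness of the summands at one maximal index i reads
    |x_j| |<u_j, u_i>| = |x_i| / d, which forces |x_j| >= |x_i|. Hence every index
    is maximal, the summands are tight at every pair of indices, and the sign
    of x_j is the one to give to u_j. *)
Lemma coherence_sharp_signs u : (0 < d)%N -> unit_system u ->
  (forall i j, i != j -> `|dot (u i) (u j)| <= d%:R^-1) ->
  exists s : 'I_d.+1 -> bool, forall i j, i != j ->
    dot ((-1) ^+ s i *: u i) ((-1) ^+ s j *: u j) = - d%:R^-1.
Proof.
move=> d0 hu hm; have [x [x0 hx]] := linear_relation u.
have tight i j : (forall k, `|x k| <= `|x i|) -> j != i ->
    x i * (x j * dot (u j) (u i)) = - (d%:R^-1 * x i ^+ 2).
  by move=> hi; apply: relation_summands_tight => // k; exact: hm.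
have [i hi] := exists_argmax x; have xi0 := argmax_neq0 _ _ x0 hi.
(* Cancelling |x_i| in the tight summand j leaves |x_j| |<u_j, u_i>| = |x_i| / d,
   to be compared with |<u_j, u_i>| <= 1/d. *)
have norm_x j : `|x j| = `|x i|.
  have [->//|ji] := eqVneq j i; apply/eqP; rewrite eq_le hi /=.
  have /(congr1 Num.norm) := tight i j hi ji.
  rewrite normrN 3!normrM normrX expr2 (mulrCA _ `|x i|).
  move=> /mulfI; rewrite normr_eq0 xi0 => /(_ isT) E.
  have dV : 0 < d%:R^-1 :> R by rewrite invr_gt0 ltr0n.
  rewrite -(ler_pM2l dV) -{1}(gtr0_norm dV) -E mulrC.
  by rewrite ler_wpM2r ?hm.
exists (fun j => x j < 0) => k j kj; rewrite dotZl dotZr dotC.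
have xE l : x l = (-1) ^+ (x l < 0)%R * `|x i|.
  by rewrite -(norm_x l) -numEsign.
have := tight k j _ _; rewrite (eq_sym j) kj => /(_ _ isT) E.
have /E : forall l, `|x l| <= `|x k| by move=> l; rewrite !norm_x.
rewrite {1 2}(xE k) {1}(xE j) (xE k) exprMn sqrr_sign mul1r -mulNr => {}E.
have n0 : `|x i| ^+ 2 != 0 by rewrite expf_eq0 normr_eq0.
by apply: (mulIf n0); rewrite -E; ring.
Qed.

(** Sign changes do not affect the |<u_i, u_j>|, so that a system whose coherence
    does not exceed 1/d has no slack at any pair. *)
Lemma coherence_eq u : (0 < d)%N -> unit_system u ->
  (forall i j, i != j -> `|dot (u i) (u j)| <= d%:R^-1) ->
  forall i j, i != j -> `|dot (u i) (u j)| = d%:R^-1.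
Proof.
move=> d0 hu hm i j ij; have [s hs] := coherence_sharp_signs u d0 hu hm.
have := congr1 Num.norm (hs i j ij).
by rewrite dotZl dotZr !normrM !normr_sign !mul1r normrN (ger0_norm (x := _^-1)) ?invr_ge0.
Qed.

(** Otherwise all the |<u_i, u_j>| would be less than 1/d, contrary to
    [coherence_eq]. *)
Lemma coherence_reached u : (0 < d)%N -> unit_system u ->
  exists i j : 'I_d.+1, (i < j)%N /\ d%:R^-1 <= `|dot (u i) (u j)|.
Proof.
move=> d0 hu; apply: contrapT => hno.
have hlt (i j : 'I_d.+1) : i != j -> `|dot (u i) (u j)| < d%:R^-1.
  move=> ij; rewrite ltNge; apply/negP => h; apply: hno.
  case: (ltngtP i j) => [lt|gt|/val_inj E]; first by exists i, j.
    by exists j, i; rewrite dotC.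
  by rewrite E eqxx in ij.
have h0m : (ord0 : 'I_d.+1) != ord_max by rewrite -val_eqE /= eq_sym -lt0n.
have := hlt _ _ h0m; rewrite coherence_eq ?ltxx // => i j ij.
exact/ltW/hlt.
Qed.

(** * Regular simplices through their inner products *)

(** If \sum_j a_j w_j = 0 with \sum_j a_j = 0, pairing with w_i leaves
    (1 + 1/d) a_i = 0. An affine relation gives such an a by putting minus the
    sum of its coefficients at the base vertex. *)
Lemma equiangular_regular_simplex w : (0 < d)%N -> unit_system w ->
  (forall i j, i != j -> dot (w i) (w j) = - d%:R^-1) ->
  regular_simplex w.
Proof.
move=> d0 hw hd; split; last first.
  exists (Num.sqrt (2 - 2 * - d%:R^-1)) => i j ij.
  by rewrite -(hd i j) // -sqr_enorm_sub // sqrtr_sqr ger0_norm // sqrtr_ge0.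
apply/freeP => k hk i.
pose S := \sum_j k j.
(* The affine relation k, moved to the form in which the base vertex carries
   the total weight S. *)
have hS : \sum_j k j *: w (lift ord0 j) = S *: w ord0.
  apply/eqP; rewrite -subr_eq0 /S scaler_suml -sumrB -[X in _ == X]hk.
  apply/eqP; apply: eq_bigr => j _.
  by rewrite (nth_map j) ?size_enum_ord // nth_ord_enum scalerBr.
have hdot := congr1 (fun v => dot v (w (lift ord0 i))) hS.
rewrite /= dotZl hd // dot_suml (bigD1 i) //= dotZl in hdot.
rewrite (iffLR (enorm_eq1 _ _ _) (hw _)) mulr1 in hdot.
rewrite (eq_bigr (fun j => k j * - d%:R^-1)) in hdot; last first.
  by move=> j ji; rewrite dotZl hd // (inj_eq lift_inj).
rewrite -mulr_suml [S](bigD1 i) //= in hdot.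
have /eqP : k i * (1 + d%:R^-1) = 0.
  by move/eqP: hdot; rewrite -subr_eq0 => /eqP <-; ring.
by rewrite mulf_eq0 [_ + _ == 0]gt_eqF ?orbF => [/eqP|]; rewrite ?addr_gt0 ?invr_gt0 ?ltr0n.
Qed.

(** Equal edges and unit vertices give one common inner product t, with t <> 1
    because the vertices are distinct. In a relation \sum_j x_j w_j = 0, pairing
    with w_i reads (1 - t) x_i = - t \sum_j x_j: the x_i are all equal, which
    leaves 1 + d t = 0. *)
Lemma regular_simplex_dot w : (0 < d)%N -> unit_system w ->
  regular_simplex w -> forall i j, i != j -> dot (w i) (w j) = - d%:R^-1.
Proof.
move=> d0 hw [wfree [l hl]].
have dn0 : d%:R != 0 :> R by rewrite pnatr_eq0 -lt0n.
pose t := 1 - l ^+ 2 / 2.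
have dotE i j : i != j -> dot (w i) (w j) = t.
  by move=> ij; rewrite /t -(hl i j ij) sqr_enorm_sub //; field.
have l0 : l != 0.
  pose e0 := Ordinal d0.
  apply/eqP => l0; have v0 : w (lift ord0 e0) - w ord0 = 0.
    by apply: enorm_eq0; rewrite hl.
  have /eqP[] : w (lift ord0 e0) - w ord0 != 0.
    by apply: (free_not0 wfree); apply/mapP; exists e0; rewrite ?mem_enum.
  exact: v0.
have t1 : 1 - t != 0.
  by rewrite /t opprB addrC subrK mulf_neq0 ?sqrf_eq0 ?invr_eq0 ?pnatr_eq0.
have [x [[k xk] hx]] := linear_relation w.
have xE i : (1 - t) * x i = - t * \sum_j x j.
  have := relation_off_diagonal w x i (hw i) (hx _).
  rewrite (eq_bigr (fun j => x j * t)); last by move=> j ji; rewrite dotE.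
  by rewrite -mulr_suml [in X in _ -> X](bigD1 i) //=; lra.
have xC i : x i = x k by apply: (mulfI t1); rewrite !xE.
have tE : t = - d%:R^-1.
  have /eqP : x k * (1 + d%:R * t) = 0.
    have := xE k; rewrite (eq_bigr (fun=> x k)) // sumr_const card_ord.
    by rewrite -mulr_natr mulrS; lra.
  rewrite mulf_eq0 (negbTE xk) /= => /eqP E.
  by apply: (mulIf dn0); rewrite mulNr mulVf //; lra.
by move=> i j ij; rewrite dotE.
Qed.

End Coherence.

(** * Pair norms of a system, and the extremal simplex *)

Section PairNorms.
Variables (R : realType) (d : nat).

Lemma pair_norm_le_max n (u : 'I_n -> 'rV[R]_d) (i j : 'I_n) (e e' : bool) :
  (i < j)%N ->
  enorm ((-1) ^+ e *: u i + (-1) ^+ e' *: u j) <= max_pair_norm u.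
Proof.
move=> ij; apply: le_trans (le_bigmax_cond _ _ (isT : xpredT i)).
apply: le_trans (le_bigmax_cond _ _ ij).
by do 2!apply: le_trans (le_bigmax_cond _ _ (isT : xpredT _)).
Qed.

Lemma max_pair_norm_le n (u : 'I_n -> 'rV[R]_d) m : unit_system u ->
  (forall i j, i != j -> `|dot (u i) (u j)| <= m) ->
  max_pair_norm u <= Num.sqrt (2 + 2 * m).
Proof.
move=> hu hm; have s0 := sqrtr_ge0 (2 + 2 * m).
apply: bigmax_le => // i _; apply: bigmax_le => // j ij.
do 2!apply: bigmax_le => // ? _.
by apply: enorm_pair_le => //; apply: hm; rewrite -val_eqE /= ltn_eqF.
Qed.

Lemma coherence_le_max_pair_norm n (u : 'I_n -> 'rV[R]_d) i j :
  unit_system u -> i != j ->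
  Num.sqrt (2 + 2 * `|dot (u i) (u j)|) <= max_pair_norm u.
Proof.
move=> hu; wlog ij : i j / (i < j)%N => [wl|_].
  case: (ltngtP i j) => [ij|ji|/val_inj->]; [exact: wl| |by rewrite eqxx].
  by rewrite eq_sym dotC; apply: wl.
by rewrite -enorm_pair_max //; exact: pair_norm_le_max.
Qed.

(** The inner product of the vectors x e_p + y (1, ..., 1) and
    x' e_q + y' (1, ..., 1), the shape of all vertices of the extremal simplex. *)
Lemma sum_affine_indicators (x y x' y' : R) (p q : 'I_d) :
  \sum_(k < d) (x * (k == p)%:R + y) * (x' * (k == q)%:R + y')
  = x * x' * (p == q)%:R + x * y' + y * x' + y * y' * d%:R.
Proof.
have sum1 (r : 'I_d) : \sum_(k < d) (k == r)%:R = 1 :> R.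
  by rewrite (bigD1 r) //= eqxx big1 ?addr0 // => k /negbTE->.
have sum2 : \sum_(k < d) (k == p)%:R * (k == q)%:R = (p == q)%:R :> R.
  by rewrite (bigD1 p) //= eqxx mul1r big1 ?addr0 // => k /negbTE->; rewrite mul0r.
under eq_bigr => k _.
  rewrite (_ : _ * _ = x * x' * ((k == p)%:R * (k == q)%:R)
    + x * y' * (k == p)%:R + y * x' * (k == q)%:R + y * y'); last by ring.
  over.
rewrite !big_split /= -!mulr_sumr sum2 !sum1 !mulr1.
by rewrite sumr_const card_ord -[_ *+ d]mulr_natr mulrA.
Qed.

(** In the coordinates of R^d, the first d vertices are obtained from the
    standard basis by a scaling and a translation along (1, ..., 1), and the
    last one, s (1, ..., 1), lies on that axis. Being a unit vector, it has
    s^2 = 1/d. For the others, a e_j - b (1, ..., 1), the difference between the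
    squared norm 1 and the inner product -1/d is a^2 = 1 + 1/d, and the inner
    product s (a - b d) = -1/d = -s^2 with the last vertex gives b = (s + a)/d. *)
Definition simplex_vertex (i : 'I_d.+1) : 'rV[R]_d :=
  let s := Num.sqrt d%:R^-1 in
  let a := Num.sqrt (1 + d%:R^-1) in
  \row_k (if unlift ord_max i is Some j
          then a * (k == j)%:R - (s + a) / d%:R else s).

Lemma dot_simplex_vertex (i j : 'I_d.+1) : (0 < d)%N ->
  dot (simplex_vertex i) (simplex_vertex j) = if i == j then 1 else - d%:R^-1.
Proof.
move=> d0; have dn0 : d%:R != 0 :> R by rewrite pnatr_eq0 -lt0n.
have dV0 : 0 <= d%:R^-1 :> R by rewrite invr_ge0.
rewrite /dot /simplex_vertex.
set s := Num.sqrt d%:R^-1; set a := Num.sqrt (1 + d%:R^-1).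
have s2 : s * s = d%:R^-1 by rewrite -expr2 sqr_sqrtr.
have a2 : a * a = 1 + d%:R^-1 by rewrite -expr2 sqr_sqrtr // addr_ge0.
pose b := (s + a) / d%:R.
have bd : b * d%:R = s + a by rewrite /b divfK.
case: (unliftP ord_max i) => [p|] ->; case: (unliftP ord_max j) => [q|] ->.
- rewrite (inj_eq lift_inj).
  transitivity (\sum_(k < d) (a * (k == p)%:R + - b) * (a * (k == q)%:R + - b)).
    by apply: eq_bigr => k _; rewrite !mxE.
  rewrite sum_affine_indicators mulrNN -(mulrA b) bd a2.
  transitivity ((1 + d%:R^-1) * (p == q)%:R + (s * s - a * a) / d%:R).
    by rewrite /b; field.
  by rewrite a2 s2; case: eqP => _ /=; field.
- rewrite eq_sym (negbTE (neq_lift _ _)).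
  (* The last vertex has no basis component, hence the coefficient 0. *)
  transitivity (\sum_(k < d) (a * (k == p)%:R + - b) * (0 * (k == p)%:R + s)).
    by apply: eq_bigr => k _; rewrite !mxE mul0r add0r.
  rewrite sum_affine_indicators -s2.
  by transitivity (s * (a - b * d%:R)); [|rewrite bd]; ring.
- rewrite (negbTE (neq_lift _ _)).
  transitivity (\sum_(k < d) (0 * (k == q)%:R + s) * (a * (k == q)%:R + - b)).
    by apply: eq_bigr => k _; rewrite !mxE mul0r add0r.
  rewrite sum_affine_indicators -s2.
  by transitivity (s * (a - b * d%:R)); [|rewrite bd]; ring.
- rewrite eqxx; under eq_bigr do rewrite !mxE.
  by rewrite sumr_const card_ord s2 -(mulr_natr d%:R^-1) mulVf.
Qed.

Lemma simplex_vertex_unit : (0 < d)%N -> unit_system simplex_vertex.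
Proof. by move=> d0 i; apply/enorm_eq1; rewrite dot_simplex_vertex // eqxx. Qed.

End PairNorms.

Lemma signed_sum2 (R : realType) (d n : nat) (u : 'I_n -> 'rV[R]_d)
    (i : {ffun 'I_2 -> 'I_n}) (e : {ffun 'I_2 -> bool}) :
  signed_sum u i e = (-1) ^+ e ord0 *: u (i ord0) + (-1) ^+ e ord_max *: u (i ord_max).
Proof.
by rewrite /signed_sum big_ord_recl big_ord1; congr (_ + (-1) ^+ e _ *: u (i _));
  exact: val_inj.
Qed.

Theorem theorem3 (R : realType) (d : nat) (hd : (1 <= d)%N) :
  c R d d.+1 2 = Num.sqrt (2 + 2 / d%:R) /\
  (forall u : 'I_d.+1 -> 'rV[R]_d, unit_system u ->
     (max_pair_norm u = Num.sqrt (2 + 2 / d%:R) <->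
      regular_simplex_up_to_signs u)).
Proof.
have dV0 : 0 <= d%:R^-1 :> R by rewrite invr_ge0.
have sqrt_mono (x y : R) : 0 <= x -> 0 <= y ->
    (Num.sqrt (2 + 2 * x) <= Num.sqrt (2 + 2 * y)) = (x <= y).
  by move=> x0 y0; rewrite ler_sqrt ?lerD2l ?ler_pM2l //; lra.
split.
  apply/le_anti/andP; split.
    (* The regular simplex allows nothing larger. *)
    have [i [e [hi h]]] := c_guaranteed hd (hd : 2 <= d.+1)%N (simplex_vertex_unit R d hd).
    apply: le_trans h _; rewrite signed_sum2.
    apply: enorm_pair_le; try exact: simplex_vertex_unit.
    have /negbTE ij : i ord0 != i ord_max.
      have lt : (i ord0 < i ord_max)%N by exact: hi.
      by rewrite -val_eqE /= ltn_eqF.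
    by rewrite dot_simplex_vertex // ij normrN ger0_norm.
  apply: c_largest => // u hu.
  have [i [j [ij hij]]] := coherence_reached R d u hd hu.
  exists [ffun k => if k == ord0 then i else j].
  exists [ffun k => if k == ord0 then false else (dot (u i) (u j) < 0)%R].
  split.
    move=> [[|[|a]] ha] [[|[|b]] hb] //= _; by rewrite !ffunE.
  by rewrite signed_sum2 !ffunE /= enorm_pair_max // sqrt_mono.
move=> u hu; split=> [hmax|[s [hs hw]]].
  have hm i j : i != j -> `|dot (u i) (u j)| <= d%:R^-1.
    by move=> ij; rewrite -sqrt_mono // -hmax coherence_le_max_pair_norm.
  have [s hs] := coherence_sharp_signs R d u hd hu hm.
  exists s => w; have hw : unit_system w.
    move=> i; apply/enorm_eq1.
    by rewrite dotZl dotZr mulrA -expr2 sqrr_sign mul1r; apply/enorm_eq1.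
  by split=> //; exact: equiangular_regular_simplex.
have dotE i j : i != j -> `|dot (u i) (u j)| = d%:R^-1.
  move=> ij; have := regular_simplex_dot R d _ hd hw hs i j ij.
  move/(congr1 Num.norm); rewrite dotZl dotZr !normrM !normr_sign !mul1r normrN.
  by rewrite (ger0_norm dV0).
apply/le_anti/andP; split.
  by apply: max_pair_norm_le => // i j /dotE->.
have h0m : (ord0 : 'I_d.+1) != ord_max by rewrite -val_eqE /= eq_sym -lt0n.
by rewrite -(dotE _ _ h0m) coherence_le_max_pair_norm.
Qed.
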